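(* Let $a<b$ be real numbers, let $n>1$ be an integer, and let $f:[a,b]\to\mathbb{R}$ be a function such that $f^{(n-1)}$ is absolutely continuous on $[a,b]$. If $f^{(n)}\in L^2[a,b]$, then for all $\theta\in[0,1]$, $$|I-F_n|\le \frac{(b-a)^{n+\frac12}}{n!\,2^n}\,\|f^{(n)}\|_2\,\sqrt{\frac{\theta^2n^2(2n+1)-\theta(4n^2-1)+(2n-1)}{(2n+1)(2n-1)}}.$$
   Context: Notation: $I=\int_a^b f(x)\,dx$, and, for the parameter $\theta\in[0,1]$, $$F_n=(b-a)\left[(1-\theta)f\left(\tfrac{a+b}{2}\right)+\theta\,\tfrac{f(a)+f(b)}{2}\right]+\sum_{i=1}^{\lfloor (n-1)/2\rfloor}\frac{[1-\theta(2i+1)](b-a)^{2i+1}}{(2i+1)!\,2^{2i}}\,f^{(2i)}\left(\tfrac{a+b}{2}\right),$$ where $\lfloor\cdot\rfloor$ is the integer part and an empty sum is $0$. $\|f^{(n)}\|_2=\left(\int_a^b|f^{(n)}(x)|^2\,dx\right)^{1/2}$ is the usual norm on $L^2[a,b]$ ($f^{(n)}$ is defined almost everywhere). *)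

(* Defs.v *)
From HB Require Import structures.
From mathcomp Require Import all_boot all_order all_algebra.
From mathcomp Require Import all_classical all_reals all_analysis.

Set Implicit Arguments.
Unset Strict Implicit.
Unset Printing Implicit Defensive.

Import Order.TTheory GRing.Theory Num.Theory.
Import numFieldNormedType.Exports.

Local Open Scope classical_set_scope.
Local Open Scope ring_scope.

(* Derivatives of a function defined on a set A only.  A function A -> R is   *)
(* represented by a total function R -> R; for x in A none of the notions     *)
(* below depends on its values outside A.  With A = `[a, b] the derivative is *)
(* the ordinary two-sided one in the interior and one-sided at a and at b.    *)
Definition diffquot (R : realType) (f : R -> R) (x y : R) : R :=
  (f y - f x) / (y - x).

Definition derivable_on (R : realType) (A : set R) (f : R -> R) (x : R) : Prop :=
  cvg (diffquot f x y @[y --> within A x^']).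

(* At a point of A where the limit does not exist, the value is 0 (the        *)
(* default point of R chosen by lim).                                         *)
Definition derive_on (R : realType) (A : set R) (f : R -> R) (x : R) : R :=
  lim (diffquot f x y @[y --> within A x^']).

Definition deriven_on (R : realType) (A : set R) (n : nat) (f : R -> R) :
  R -> R := iter n (derive_on A) f.

(* That is, the iterated derivatives up to order k included exist at every    *)
(* point of A.                                                                *)
Definition derivablen_on (R : realType) (A : set R) (k : nat) (f : R -> R) :
  Prop :=
  forall j, (j < k)%N -> forall x, A x -> derivable_on A (deriven_on A j f) x.

(* The subintervals [u i, v i] may share endpoints or be degenerate.          *)
Definition abs_continuous (R : realType) (a b : R) (g : R -> R) : Prop :=
  forall e : R, 0 < e -> exists2 d : R, 0 < d &
    forall (m : nat) (u v : 'I_m -> R),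
      (forall i, [/\ a <= u i, u i <= v i & v i <= b]) ->
      trivIset [set: 'I_m] (fun i => `]u i, v i[%classic) ->
      \sum_(i < m) (v i - u i) < d ->
      \sum_(i < m) `|g (v i) - g (u i)| < e.

(* L^2[a, b] is seen inside L^2(R), through the extension by 0.               *)
Definition in_L2 (R : realType) (a b : R) (g : R -> R) : Prop :=
  g \_ `[a, b] \in Lfun (@lebesgue_measure R) 2%:E.

Definition L2norm (R : realType) (a b : R) (g : R -> R) : R :=
  fine ('N[@lebesgue_measure R]_(2%:E) [EFin \o g \_ `[a, b]])%E.

Definition quadF (R : realType) (a b : R) (f : R -> R) (theta : R) (n : nat) :
  R :=
  (b - a) * ((1 - theta) * f ((a + b) / 2) + theta * ((f a + f b) / 2))
  + \sum_(1 <= i < ((n - 1) %/ 2).+1)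
      (1 - theta * (2 * i + 1)%:R) * (b - a) ^+ (2 * i + 1)
        / ((2 * i + 1)`!%:R * 2 ^+ (2 * i))
      * deriven_on `[a, b] (2 * i) f ((a + b) / 2).

(* Main.v *)
(* Integrating by parts n times on each half of [a, b], the error I - F_n is  *)
(* (-1)^n times the integral of K f^(n), where K is a polynomial Peano kernel *)
(* on each half; the boundary terms at the midpoint vanish for even orders    *)
(* and give the terms of F_n for odd ones. The bound is then Cauchy-Schwarz,  *)
(* the L^2 norm of K being computed explicitly.                               *)
(* The last integration by parts needs the fundamental theorem of calculus    *)
(* for an absolutely continuous g. Write g as a difference of nondecreasing   *)
(* absolutely continuous functions by means of its total variation. The       *)
(* Lebesgue-Stieltjes measures of these are dominated by Lebesgue measure, so *)
(* they have Radon-Nikodym densities, and Lebesgue's differentiation theorem  *)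
(* identifies the resulting density of g with g' almost everywhere.           *)
Require Import Defs.
From HB Require Import structures.
From mathcomp Require Import all_boot all_order all_algebra.
From mathcomp Require Import all_classical all_reals all_analysis.
From mathcomp Require Import measurable_realfun zify ring lra.
Set Implicit Arguments.
Unset Strict Implicit.
Unset Printing Implicit Defensive.

Import Order.TTheory GRing.Theory Num.Theory.
Import numFieldNormedType.Exports.

Local Open Scope classical_set_scope.
Local Open Scope ring_scope.

(** Put h = (b-a)/2, m = (a+b)/2 and P_k(x) = (x-c)^k/k! + l (x-c)^(k-1)/(k-1)!, P_0 = 1, with c =
    a, l = -theta h on the left half and c = b, l = theta h on the right half. Since P_(k+1)' = P_k,
    integrating by parts replaces the integral of P_k f^(k) by minus that of P_(k+1) f^(k+1), up to
    boundary terms. The first round yields the theta-mean of the midpoint and trapezoidal values.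
    Every later round leaves only the jump of P_(k+1) at m, which is 0 for odd k and the coefficient
    of f^(k)(m) in F_n for even k. This is [peano_identity]; [cauchy_schwarz_L2] and
    [sqr_norm_peano_kernel] turn it into the bound.

    The delicate round is the last one, where the derivative exists only almost everywhere. There
    [abs_continuous_ibp] rests on [abs_continuous_density]: an absolutely continuous function is the
    primitive of its derivative. [abs_continuous_total_variation] reduces this to monotone
    functions, and [lebesgue_stieltjes_null] gives the domination needed for Radon-Nikodym. *)

(** * Absolute continuity and total variation *)

(* An interval is encoded by the pair (left endpoint, right endpoint). *)
Definition itv_apart (R : realType) (p q : R * R) :=
  (p.2 <= q.1) || (q.2 <= p.1).

Definition itv_family (R : realType) (a b : R) (s : seq (R * R)) :=
  all (fun p => [&& a <= p.1, p.1 < p.2 & p.2 <= b]) s &&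
  pairwise (@itv_apart R) s.

(** Lists, unlike families indexed by ['I_m], are easily spliced, as refining the intervals
    requires. *)
Lemma abs_continuous_seq (R : realType) (a b : R) (g : R -> R) :
  abs_continuous a b g -> forall e : R, 0 < e -> exists2 d : R, 0 < d &
    forall s, itv_family a b s -> \sum_(p <- s) (p.2 - p.1) < d ->
      \sum_(p <- s) `|g p.2 - g p.1| < e.
Proof.
move=> ac e /ac[d d0 ad]; exists d => // s /andP[/allP sab sap] sd.
rewrite big_tnth; rewrite big_tnth in sd.
apply: (ad _ (fun i => (tnth (in_tuple s) i).1)
             (fun i => (tnth (in_tuple s) i).2)) => //.
  by move=> i; have /sab/and3P[? /ltW ? ?] := mem_tnth i (in_tuple s).
pose x0 : R * R := (0, 0).
have apart (i j : 'I_(size s)) : (i < j)%N ->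
    itv_apart (tnth (in_tuple s) i) (tnth (in_tuple s) j).
  rewrite !(tnth_nth x0) /= => ij.
  by move/(pairwiseP x0): sap => /(_ i j (ltn_ord i) (ltn_ord j) ij).
move=> i j _ _ [z []] /=; rewrite !in_itv/= => /andP[? ?] /andP[? ?].
case: (ltngtP i j) => [/apart|/apart|]; last exact: val_inj.
  by rewrite /itv_apart => ?; exfalso; lra.
by rewrite /itv_apart => ?; exfalso; lra.
Qed.

Lemma itv_family_cat (R : realType) (a b : R) (s t : seq (R * R)) :
  itv_family a b (s ++ t) =
  [&& itv_family a b s, itv_family a b t & allrel (@itv_apart R) s t].
Proof.
rewrite /itv_family all_cat pairwise_cat.
case: (all _ s) => //=; case: (all _ t) => //=; last by rewrite andbF.
by case: allrel; rewrite ?andbF ?andbT.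
Qed.

Lemma variation_pairs (R : realType) (a b : R) (f : R -> R) (s : seq R) :
  itv_partition a b s ->
  variation a b f s = \sum_(p <- zip (a :: s) s) `|f p.2 - f p.1|.
Proof.
move=> abs; rewrite variation_zip//; elim: s a {abs} => [|h t ih] a /=.
  by rewrite !big_nil.
by rewrite !big_cons ih.
Qed.

Lemma sum_pairs (R : realType) (a b : R) (s : seq R) :
  itv_partition a b s -> \sum_(p <- zip (a :: s) s) (p.2 - p.1) = b - a.
Proof.
elim: s a => [|h t ih] a /=; first by move/itv_partition_nil ->; rewrite big_nil subrr.
by move/itv_partition_cons/ih => hb; rewrite big_cons hb/=; ring.
Qed.

Lemma itv_family_pairs (R : realType) (a b : R) (s : seq R) :
  itv_partition a b s -> itv_family a b (zip (a :: s) s).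
Proof.
suff H c : c <= a -> itv_partition a b s ->
    itv_family c b (zip (a :: s) s) by apply: H.
elim: s a c => // h t ih a c ca abs /=.
have hb := itv_partition_le (itv_partition_cons abs).
have ah : a < h by case: abs => /andP[].
have /andP[ht1 ht2] := ih h h (lexx _) (itv_partition_cons abs).
apply/andP; split => /=; apply/andP; split => //=.
- by rewrite ca ah hb.
- by apply: sub_all ht1 => p /and3P[? -> ->]; rewrite !andbT; lra.
- by apply: sub_all ht1 => p /and3P[? ? ?]; rewrite /itv_apart/=; apply/orP; left.
Qed.

(** Partitioning each interval keeps the family disjoint and its total length unchanged, so the
    bound on increments passes to variations; taking suprema weakens [<] to [<=]. *)
Lemma total_variation_seq (R : realType) (a b : R) (g : R -> R) :
  abs_continuous a b g -> forall e : R, 0 < e -> exists2 d : R, 0 < d &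
    forall s, itv_family a b s -> \sum_(p <- s) (p.2 - p.1) < d ->
      (\sum_(p <- s) total_variation p.1 p.2 g <= e%:E)%E.
Proof.
move=> /abs_continuous_seq ac e /ac[d d0 ad]; exists d => // s0 s0f s0d.
(* Replace the intervals of s one by one by arbitrary finite partitions, which *)
(* are moved to c, and take the supremum over each partition in turn.          *)
have H s c : itv_family a b (c ++ s) -> \sum_(p <- c ++ s) (p.2 - p.1) < d ->
  (\sum_(p <- s) total_variation p.1 p.2 g +
   (\sum_(p <- c) `|g p.2 - g p.1|)%:E <= e%:E)%E.
  elim: s c => [|p s ih] c.
    by rewrite cats0 big_nil add0e lee_fin => cf /(ad _ cf)/ltW.
  move=> cf cd; rewrite big_cons -addeA.
  have tv0 : (0 <= \sum_(p <- s) total_variation p.1 p.2 g)%E.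
    rewrite big_seq sume_ge0// => q qs; apply: total_variation_ge0.
    move: cf => /andP[/allP /(_ q) + _]; rewrite mem_cat inE qs !orbT.
    by case/(_ isT)/and3P => _ /ltW.
  have part t : itv_partition p.1 p.2 t ->
    ((variation p.1 p.2 g t)%:E + (\sum_(p <- s) total_variation p.1 p.2 g +
      (\sum_(p <- c) `|g p.2 - g p.1|)%:E) <= e%:E)%E.
    move=> pt; rewrite variation_pairs// addeCA -EFinD -big_cat/=; apply: ih.
      move: cf; rewrite -cat1s catA !itv_family_cat => /and3P[/and3P[cf pf cp] sf].
      rewrite allrel_catl => /andP[cs ps].
      have := itv_family_pairs pt; set z := zip _ _ => zf.
      have zp q : q \in z -> p.1 <= q.1 /\ q.2 <= p.2.
        by move=> qz; case/andP: zf => /allP/(_ q qz)/and3P[].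
      have pab : a <= p.1 /\ p.2 <= b by case/andP: pf => /= /andP[/and3P[]].
      rewrite cf sf allrel_catl cs !andbT /= -andbA.
      apply/and3P; split.
      - apply/andP; split; last by case/andP: zf.
        apply/allP => q qz; case/andP: zf => /allP/(_ q qz)/and3P[? ? ?] _.
        by apply/and3P; split => //; lra.
      - apply/allrelP => q r qz rc.
        have := zp _ qz; move/allrelP: cp => /(_ r p rc); rewrite inE eqxx.
        by move=> /(_ isT); rewrite /itv_apart; lra.
      - apply/allrelP => q r qz rs.
        have := zp _ qz; move/allrelP: ps => /(_ p r); rewrite inE eqxx rs.
        by move=> /(_ isT isT); rewrite /itv_apart; lra.
    move: cd; rewrite !big_cat/= big_cons (sum_pairs pt).
    by rewrite addrA [X in X + _]addrC.
  set S := (X in (_ + X <= _)%E); have S0 : (0 <= S)%E.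
    by rewrite adde_ge0 ?lee_fin ?sumr_ge0.
  have pp : p.1 < p.2.
    move: cf => /andP[/allP /(_ p) + _]; rewrite mem_cat inE eqxx orbT.
    by case/(_ isT)/and3P.
  (* The one-piece partition in [part] already bounds [S], so [S] can be moved across the inequality
     before taking the supremum over [t]. *)
  have Sfin : S \is a fin_num.
    have /part := itv_partition1 pp.
    rewrite ge0_fin_numE// => h; apply: le_lt_trans (ltry e).
    apply: le_trans h; rewrite -/S leeDr// lee_fin; exact: variation_ge0.
  rewrite -leeBrDr//; apply: ge_ereal_sup => _ [_ [t pt <-] <-].
  by rewrite leeBrDr//; exact: part.
by have := H s0 [::] s0f s0d; rewrite big_nil adde0.
Qed.

(** Cut [[a, b]] into [N] equal pieces shorter than the [d] attached to 1: each has variation at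
    most 1, so the total is at most [N]. *)
Lemma abs_continuous_bounded_variation (R : realType) (a b : R) (g : R -> R) :
  a <= b -> abs_continuous a b g -> bounded_variation a b g.
Proof.
move=> ab /total_variation_seq /(_ 1 ltr01)[d d0 tvd].
have tv1 x y : a <= x -> x <= y -> y <= b -> y - x < d ->
    (total_variation x y g <= 1%:E)%E.
  rewrite [x <= y]le_eqVlt => ax /predU1P[<-|xy] yb xyd.
    by rewrite total_variationxx lee_fin.
  have := tvd [:: (x, y)]; rewrite !big_seq1; apply => //.
  by rewrite /itv_family /= ax xy yb.
pose N := (Num.truncn ((b - a) / d)).+1.
have N0 : 0 < N%:R :> R by rewrite ltr0n.
have Nd : (b - a) / N%:R < d.
  by rewrite ltr_pdivrMr// mulrC -ltr_pdivrMr//; apply: truncnS_gt.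
set t := (b - a) / N%:R in Nd.
have t0 : 0 <= t by rewrite divr_ge0// subr_ge0.
have tvk k : (k <= N)%N -> (total_variation a (a + t * k%:R) g <= k%:R%:E)%E.
  elim: k => [_|k ih kN]; first by rewrite mulr0 addr0 total_variationxx.
  have tk : a + t * k.+1%:R <= b.
    rewrite -lerBrDl; apply: (@le_trans _ _ (t * N%:R)).
      by rewrite ler_wpM2l// ler_nat.
    by rewrite divfK// gt_eqF.
  have tk0 : 0 <= t * k%:R by rewrite mulr_ge0.
  have tk1 : t * k%:R <= t * k.+1%:R by rewrite ler_wpM2l// ler_nat.
  rewrite (@total_variationD _ _ _ (a + t * k%:R)) ?lerDl ?lerD2l//.
  rewrite -[in leRHS]natr1 EFinD leeD ?ih// 1?ltnW//; apply: tv1.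
  - by rewrite lerDl.
  - by rewrite lerD2l.
  - by [].
  - by rewrite -natr1 mulrDr; lra.
apply/bounded_variationP => //; rewrite ge0_fin_numE ?total_variation_ge0//.
have := tvk N (leqnn N); rewrite divfK ?gt_eqF// addrC subrK.
by move=> /le_lt_trans; apply; rewrite ltry.
Qed.

Lemma fine_total_variationB (R : realType) (a b x y : R) (g : R -> R) :
  bounded_variation a b g -> a <= x -> x <= y -> y <= b ->
  fine (total_variation a y g) - fine (total_variation a x g) =
  fine (total_variation x y g).
Proof.
move=> bv ax xy yb; have ay := le_trans ax xy; have xb := le_trans xy yb.
have tvx : total_variation a x g \is a fin_num.
  by apply/bounded_variationP => //; exact: bounded_variationl bv.
have tvxy : total_variation x y g \is a fin_num.
  apply/bounded_variationP => //; apply: (@bounded_variationl _ _ _ b) => //.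
  exact: (@bounded_variationr _ a).
by rewrite (total_variationD g ax xy) fineD// addrC addKr.
Qed.

(** The increments of the variation function are the variations over the intervals, which
    [total_variation_seq] controls; [e / 2] restores the strict inequality. *)
Lemma abs_continuous_total_variation (R : realType) (a b : R) (g : R -> R) :
  a <= b -> abs_continuous a b g ->
  abs_continuous a b (fun x => fine (total_variation a x g)).
Proof.
move=> ab ac e e0; have bv := abs_continuous_bounded_variation ab ac.
have /(total_variation_seq ac)[d d0 tvd] : 0 < e / 2 by rewrite divr_gt0.
exists d => // m u v uv uvtriv uvd.
(* Degenerate intervals are excluded from an [itv_family]; dropping them does not change the sums,
   by [sE]. *)
pose s := [seq (u i, v i) | i <- enum 'I_m & u i < v i].
have sE (T : nmodType) (F : R * R -> T) : (forall i, u i = v i -> F (u i, v i) = 0) ->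
    \sum_(p <- s) F p = \sum_(i < m) F (u i, v i).
  move=> F0; rewrite big_map big_filter big_enum_cond /=.
  rewrite [RHS](bigID (fun i => u i < v i))/= [X in _ = _ + X]big1 ?addr0//.
  move=> i; rewrite -leNgt => vu; apply: F0; apply: le_anti.
  by rewrite vu; case: (uv i) => _ ->.
have sf : itv_family a b s.
  apply/andP; split.
    apply/allP => p /mapP[i]; rewrite mem_filter => /andP[uvi _] ->/=.
    by case: (uv i) => -> _ ->; rewrite uvi.
  rewrite pairwise_map; apply: (@sub_in_pairwise _ (fun i => u i < v i)
    (fun i j => i != j)); last 2 first.
  - by apply/allP => i; rewrite mem_filter => /andP[].
  - by rewrite -uniq_pairwise filter_uniq// enum_uniq.
  move=> i j; rewrite !unfold_in /= => uvi uvj ij; rewrite /itv_apart/=; apply/negPn/negP.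
  rewrite negb_or -!ltNge => /andP[vj vi]; move/eqP: ij; apply.
  (* If neither interval preceded the other, the midpoint of []l, r[] would lie in both. *)
  apply: uvtriv => //; pose l := Num.max (u i) (u j); pose r := Num.min (v i) (v j).
  have lr : l < r by rewrite /l /r lt_min !gt_max uvi uvj vi vj.
  exists ((l + r) / 2); split; rewrite /= in_itv/=.
  - have : u i <= l by rewrite le_max lexx.
    have : r <= v i by rewrite ge_min lexx.
    by move=> ? ?; apply/andP; split; lra.
  - have : u j <= l by rewrite le_max lexx orbT.
    have : r <= v j by rewrite ge_min lexx orbT.
    by move=> ? ?; apply/andP; split; lra.
have := tvd s sf; rewrite !sE/=; first last.
- by move=> i ->; rewrite subrr.
- by move=> i ->; rewrite total_variationxx.
move=> /(_ uvd) tve.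
rewrite (@le_lt_trans _ _ (e / 2))//; last by lra.
rewrite -lee_fin; apply: le_trans tve; rewrite -sumEFin le_eqVlt; apply/orP; left.
apply/eqP; apply: eq_bigr => i _; case: (uv i) => au uvi vb.
rewrite (fine_total_variationB bv)// ger0_norm ?fine_ge0 ?total_variation_ge0//.
rewrite fineK//; apply/bounded_variationP => //.
by apply: (@bounded_variationl _ _ _ b) => //; apply: (@bounded_variationr _ a _ b) => //;
  exact: le_trans vb.
Qed.

Lemma abs_continuousB (R : realType) (a b : R) (f g : R -> R) :
  abs_continuous a b f -> abs_continuous a b g ->
  abs_continuous a b (fun x => f x - g x).
Proof.
move=> acf acg e e0; have e20 : 0 < e / 2 by rewrite divr_gt0.
have [d1 d10 fd] := acf _ e20; have [d2 d20 gd] := acg _ e20.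
exists (Num.min d1 d2); first by rewrite lt_min d10.
move=> m u v uv uvt; rewrite lt_min => /andP[uvd1 uvd2].
have := fd m u v uv uvt uvd1; have := gd m u v uv uvt uvd2.
move=> ge fe; rewrite [e]splitr; apply: le_lt_trans (ltrD fe ge).
rewrite -big_split; apply: ler_sum => i _ /=.
rewrite (_ : _ - _ = (f (v i) - f (u i)) - (g (v i) - g (u i))); last by ring.
exact: ler_normB.
Qed.

(** * Absolutely continuous functions are primitives *)

(** The projection onto [[a, b]]: composing with it extends a function from [[a, b]] to the line by
    constants. *)
Definition clamp (R : realType) (a b x : R) : R := Num.max a (Num.min x b).

Lemma clamp_itv (R : realType) (a b x : R) : a <= b -> a <= clamp a b x <= b.
Proof. by move=> ab; rewrite le_max lexx ge_max ab ge_min lexx orbT. Qed.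

Lemma clamp_id (R : realType) (a b x : R) : a <= x <= b -> clamp a b x = x.
Proof. by case/andP => ax xb; rewrite /clamp min_l// max_r. Qed.

Lemma clamp_le (R : realType) (a b x y : R) : x <= y -> clamp a b x <= clamp a b y.
Proof.
by move=> xy; rewrite /clamp ge_max le_max lexx/= le_max le_min !ge_min xy lexx !orbT.
Qed.

Lemma clampB (R : realType) (a b x y : R) : a <= b -> x <= y ->
  clamp a b y - clamp a b x <= y - x.
Proof.
move=> ab xy; rewrite /clamp.
have [xb|xb] := leP x b; have [yb|yb] := leP y b; rewrite ?(max_r ab).
- by have [ax|ax] := leP a x; have [ay|ay] := leP a y; lra.
- by have [ax|ax] := leP a x; lra.
- by have [ay|ay] := leP a y; lra.
- by lra.
Qed.

Lemma clamp_itvoo (R : realType) (a b x y : R) :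
  `]clamp a b x, clamp a b y[ `<=` `]x, y[.
Proof.
move=> z; rewrite /= !in_itv/= /clamp gt_max lt_max lt_min gt_min => /andP[].
move=> /andP[az xbz]; lra.
Qed.

Lemma abs_continuous_dist (R : realType) (a b : R) (g : R -> R) (e : R) :
  abs_continuous a b g -> 0 < e -> exists2 d : R, 0 < d &
    forall x y, a <= x -> x <= y -> y <= b -> y - x < d -> `|g y - g x| < e.
Proof.
move=> ac /ac[d d0 ad]; exists d => // x y ax xy yb xyd.
have := ad 1%N (fun=> x) (fun=> y); rewrite !big_ord1; apply => //.
by move=> i j _ _ _; rewrite !ord1.
Qed.

(** A Lebesgue-Stieltjes measure needs a nondecreasing right-continuous function on the whole line;
    [clamp] provides it because it is monotone and does not increase distances. *)
Lemma cumulative_clamp (R : realType) (a b : R) (F : R -> R) : a <= b ->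
  abs_continuous a b F -> {in `[a, b] &, nondecreasing F} ->
  exists G : cumulative R R, forall x, G x = F (clamp a b x).
Proof.
move=> ab ac ndF; pose G x := F (clamp a b x).
have Gnd : nondecreasing G.
  by move=> x y xy; apply: ndF; rewrite ?in_itv/= ?clamp_itv// clamp_le.
have Grc : right_continuous G.
  move=> x; apply/cvgrPdist_lt => e /(abs_continuous_dist ac)[d d0 ad].
  near=> y; rewrite distrC; apply: ad.
  - by case/andP: (clamp_itv x ab).
  - by apply: clamp_le; near: y; exact: nbhs_right_ge.
  - by case/andP: (clamp_itv y ab).
  - apply: le_lt_trans (clampB ab _) _; first by near: y; exact: nbhs_right_ge.
    by rewrite ltrBlDr; near: y; apply: nbhs_right_lt; rewrite ltrDr.
by exists (HB.pack_for (cumulative R R) G (isCumulative.Build R _ R G Gnd Grc)).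
Unshelve. all: by end_near. Qed.

Lemma lebesgue_stieltjes_measure_itvoc (R : realType) (G : cumulative R R) (x y : R) :
  x <= y -> lebesgue_stieltjes_measure G `]x, y] = (G y - G x)%:E.
Proof.
move=> xy; rewrite /lebesgue_stieltjes_measure/= /measure_extension/=.
rewrite measurable_mu_extE/=; last exact: is_ocitv.
by rewrite wlength_itv_bnd.
Qed.

(** These are the connected components of [U]. Boundedness makes their infimum and supremum real
    endpoints; an empty member of the sequence is coded by equal endpoints. *)
Lemma open_bounded_itv_seq (R : realType) (U : set R) (a b : R) :
  open U -> U `<=` `]a, b[ -> exists x y : nat -> R,
    [/\ forall k, x k <= y k, trivIset setT (fun k => `]x k, y k[%classic) &
        U = \bigcup_k `]x k, y k[%classic].
Proof.
move=> oU Uab; pose I := open_disjoint_itv oU.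
have UE : U = \bigcup_k I k := open_disjoint_itv_bigcup oU.
have /choice[xy Ixy] k : exists p : R * R, p.1 <= p.2 /\ I k = `]p.1, p.2[%classic.
  have [Ik0|/set0P[z Ikz]] := eqVneq (I k) set0.
    by exists (0, 0); split => //=; rewrite Ik0 set_itvoo0.
  exists (inf (I k), sup (I k)).
  have Iab w : I k w -> a < w < b.
    by move=> Ikw; have /Uab : U w by rewrite UE; exists k.
  have lb : has_lbound (I k) by exists a => w /Iab/andP[/ltW].
  have ub : has_ubound (I k) by exists b => w /Iab/andP[_ /ltW].
  split => /=; first by apply: (@le_trans _ _ z); [exact: ge_inf|exact: ub_le_sup].
  have /interior_id IkE : open (I k) by exact: open_disjoint_itv_open.
  rewrite -[LHS]IkE.
  rewrite interval_bounded_interior//; last exact: open_disjoint_itv_is_interval.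
exists (fst \o xy), (snd \o xy); split => /=.
- by move=> k; case: (Ixy k).
- have := @open_disjoint_itv_trivIset _ _ oU.
  by congr trivIset; apply/funext => k; case: (Ixy k).
- by rewrite UE; apply: eq_bigcupr => k _; case: (Ixy k).
Qed.

Lemma lebesgue_stieltjes_null (R : realType) (a b : R) (F : R -> R)
    (G : cumulative R R) (A : set (measurableTypeR R)) :
  a <= b -> abs_continuous a b F -> (forall x, G x = F (clamp a b x)) ->
  measurable A -> A `<=` `]a, b] -> lebesgue_measure A = 0%E ->
  lebesgue_stieltjes_measure G A = 0%E.
Proof.
(* Cover A by an open set of small length: absolute continuity bounds the    *)
(* measure of any finitely many of its component intervals.                  *)
move=> ab ac GF mA Aab A0; apply/eqP; rewrite eq_le measure_ge0 andbT.
apply/lee_addgt0Pr => e e0; rewrite add0e.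
have [d d0 ad] := ac e e0.
have [U0 [oU0 AU0]] : exists U : set R,
    [/\ open U, A `<=` U & (lebesgue_measure (U `\` A) < d%:E)%E].
  have Ay : (lebesgue_measure A < +oo)%E by rewrite A0 ltry.
  exact: (lebesgue_regularity_outer mA Ay d0).
have mU0 : measurable (U0 : set (measurableTypeR R)) by exact: measurable_realfun.open_measurable.
move=> U0A; have U0d : (lebesgue_measure U0 < d%:E)%E.
  rewrite (measureDI _ mU0 mA) [X in (_ + X)%E](_ : _ = 0%E) ?adde0//.
  by apply: (subset_measure0 _ mA (@subIsetr _ _ _) A0); exact: measurableI.
(* [U0] may be unbounded. The cut makes the component intervals bounded and still covers [A], which
   lies in []a, b]]. *)
pose U := U0 `&` `]a - 1, b + 1[%classic.
have oU : open U by apply: openI => //; exact: interval_open.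
have mU : measurable (U : set (measurableTypeR R)) by exact: measurable_realfun.open_measurable.
have AU : A `<=` U.
  move=> x Ax; split; first exact: AU0.
  by move: (Aab _ Ax); rewrite /= !in_itv/=; lra.
have [x [y [xy xytriv UE]]] := open_bounded_itv_seq oU (@subIsetr _ _ _).
have mI k : measurable (`]x k, y k[%classic : set (measurableTypeR R)).
  exact: measurable_itv.
have clxy k : clamp a b (x k) <= clamp a b (y k) by exact: clamp_le.
apply: (@le_trans _ _ (lebesgue_stieltjes_measure G U)).
  by rewrite le_measure ?inE.
rewrite UE measure_semi_bigcup//; last by rewrite -UE.
apply: lime_le; first exact: is_cvg_nneseries.
apply: nearW => m; rewrite big_mkord.
have cd : \sum_(i < m) (clamp a b (y i) - clamp a b (x i)) < d.
  rewrite -lte_fin; apply: le_lt_trans U0d.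
  apply: (@le_trans _ _ (lebesgue_measure U)); last first.
    by rewrite le_measure ?inE//; exact: subIsetl.
  rewrite UE measure_semi_bigcup//; last by rewrite -UE.
  apply: le_trans (nneseries_lim_ge m _); last by [].
  rewrite big_mkord -sumEFin; apply: lee_sum => i _.
  have Ii : lebesgue_measure (`]x i, y i[%classic : set R) = (y i - x i)%:E.
    rewrite lebesgue_measure_itv/= lte_fin; have := xy i.
    rewrite le_eqVlt => /predU1P[->|->]; first by rewrite ltxx subrr.
    by rewrite -EFinB.
  by apply: (@le_trans _ _ (y i - x i)%:E); [rewrite lee_fin clampB|
    rewrite -Ii; exact: lexx].
have triv : trivIset [set: 'I_m]
    (fun i : 'I_m => `]clamp a b (x i), clamp a b (y i)[%classic).
  move=> i j _ _ [z [/clamp_itvoo zi /clamp_itvoo zj]].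
  by apply/val_inj/(xytriv i j) => //; exists z.
have := ad m (fun i => clamp a b (x i)) (fun i => clamp a b (y i)).
move=> /(_ _ triv cd) h; apply: (@le_trans _ _
    (\sum_(i < m) `|F (clamp a b (y i)) - F (clamp a b (x i))|)%:E); last first.
  rewrite lee_fin ltW// h// => i; split => //.
    by case/andP: (clamp_itv (x i) ab).
  by case/andP: (clamp_itv (y i) ab).
rewrite -sumEFin; apply: lee_sum => i _.
apply: (@le_trans _ _ (lebesgue_stieltjes_measure G `]x i, y i])).
  by rewrite le_measure ?inE// => z; rewrite /= !in_itv/= => /andP[-> /ltW].
by rewrite lebesgue_stieltjes_measure_itvoc// lee_fin !GF ler_norm.
Qed.

(** The Stieltjes measure of the clamped [F], restricted to []a, b]], is finite and dominated by
    Lebesgue measure. Its Radon-Nikodym density, integrated over []a, x]], recovers [F x - F a]. *)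
Lemma abs_continuous_nondecreasing_density (R : realType) (a b : R) (F : R -> R) :
  a <= b -> abs_continuous a b F -> {in `[a, b] &, nondecreasing F} ->
  exists2 h : R -> R,
    (@lebesgue_measure R).-integrable setT (EFin \o h) &
    forall x, a <= x <= b ->
      F x = F a + \int[@lebesgue_measure R]_(t in `[a, x]) h t.
Proof.
move=> ab ac ndF; have [G GF] := cumulative_clamp ab ac ndF.
pose D : set (measurableTypeR R) := `]a, b]%classic.
have mD : measurable D by exact: measurable_itv.
have mitv (x y : R) : measurable (`]x, y]%classic : set (measurableTypeR R)).
  exact: measurable_itv.
have GD : (lebesgue_stieltjes_measure G D < +oo)%E.
  by rewrite lebesgue_stieltjes_measure_itvoc// ltry.
pose nu := mfrestr mD GD.
have dom : nu `<< @lebesgue_measure R.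
  apply/null_content_dominatesP => A mA A0; rewrite /nu /mfrestr /mrestr.
  apply: (lebesgue_stieltjes_null ab ac GF).
  - exact: measurableI.
  - exact: subIsetr.
  - by apply: (subset_measure0 _ mA (@subIsetl _ _ _) A0); exact: measurableI.
have [f [f0 ffin intf nuf]] := radon_nikodym_sigma_finite dom.
pose h : R -> R := fine \o f.
have ih : (@lebesgue_measure R).-integrable setT (EFin \o h).
  by apply: eq_integrable intf => // x _; rewrite /h /= fineK.
exists h => //.
move=> x /[dup] axb /andP[ax xb].
have nuax : nu `]a, x]%classic = (F x - F a)%:E.
  rewrite /nu /mfrestr /mrestr (_ : _ `&` _ = `]a, x]%classic).
    by rewrite lebesgue_stieltjes_measure_itvoc// !GF !clamp_id// lexx.
  by apply/seteqP; split => z; rewrite /D /= !in_itv/=; [case|move=> ?; split => //]; lra.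
rewrite -Rintegral_itv_obnd_cbnd; last first.
  by apply: integrableS ih => //; exact: measurable_itv.
suff hE : (\int[@lebesgue_measure R]_(t in `]a, x]) (h t)%:E = (F x - F a)%:E)%E.
  by rewrite /Rintegral hE /= addrC subrK.
apply: esym; apply: etrans (esym nuax) (etrans (nuf _ (mitv a x)) _).
by apply: eq_integral => t _; rewrite /h /= fineK.
Qed.

Lemma abs_continuous_density (R : realType) (a b : R) (g : R -> R) :
  a < b -> abs_continuous a b g ->
  exists h : R -> R,
    [/\ (@lebesgue_measure R).-integrable setT (EFin \o h),
      forall x, a <= x <= b ->
        g x = g a + \int[@lebesgue_measure R]_(t in `[a, x]) h t &
      {ae @lebesgue_measure R, forall x, a < x < b -> is_derive x 1 g (h x)}].
Proof.
(* Jordan decomposition: g = V - (V - g) with V the total variation. *)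
move=> ltab ac; have ab := ltW ltab.
have bv := abs_continuous_bounded_variation ab ac.
pose V x := fine (total_variation a x g).
have acV : abs_continuous a b V := abs_continuous_total_variation ab ac.
have VB := fine_total_variationB bv.
have Vnd : {in `[a, b] &, nondecreasing V}.
  move=> x y; rewrite !in_itv/= => /andP[ax xb] /andP[ay yb] xy.
  by rewrite -subr_ge0 VB// fine_ge0// total_variation_ge0.
have Ng : {in `[a, b] &, nondecreasing (fun x => V x - g x)}.
  move=> x y; rewrite !in_itv/= => /andP[ax xb] /andP[ay yb] xy.
  have : g y - g x <= V y - V x.
    rewrite VB//; apply: le_trans (ler_norm _) _.
    rewrite -lee_fin fineK ?total_variation_ge//; apply/bounded_variationP => //.
    by apply: (@bounded_variationl _ _ _ b) => //; exact: (@bounded_variationr _ a).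
  by move=> ?; lra.
have [h1 ih1 h1E] := abs_continuous_nondecreasing_density ab acV Vnd.
have [h2 ih2 h2E] :=
  abs_continuous_nondecreasing_density ab (abs_continuousB acV ac) Ng.
pose h x := h1 x - h2 x.
have ih : (@lebesgue_measure R).-integrable setT (EFin \o h).
  by apply: eq_integrable (integrableB measurableT ih1 ih2).
have iS (k : R -> R) (A : set R) : measurable (A : set (measurableTypeR R)) ->
    (@lebesgue_measure R).-integrable setT (EFin \o k) ->
    (@lebesgue_measure R).-integrable A (EFin \o k).
  by move=> mA; apply: integrableS.
have hE x : a <= x <= b ->
    g x = g a + \int[@lebesgue_measure R]_(t in `[a, x]) h t.
  move=> axb; rewrite RintegralB//; try by apply: iS.
  by have := h1E x axb; have := h2E x axb; lra.
exists h; split => //.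
(* By Lebesgue differentiation the primitive of [h] has derivative [h] almost everywhere; near an
   interior point [g] coincides with that primitive. *)
have := @FTC1 _ h (BLeft a).
move=> /(_ (fun y => iS _ _ (measurable_itv _) ih)).
move=> /(_ (open_integrable_locally openT ih)).
apply: (@filterS _ _ (ae_filter_ringOfSetsType _)) => x /= Fx /andP[ax xb].
have [dF F'] := Fx ax.
pose F y := g a + \int[@lebesgue_measure R]_(t in `[a, y]) h t.
have dx : is_derive x 1 F (h x).
  by rewrite -F' derive1E -[X in is_derive _ _ _ X]add0r; apply: is_deriveD.
apply: (near_eq_is_derive _ dx).
near=> y; apply/esym/hE; apply/andP; split; apply/ltW; near: y.
  exact: lt_nbhsr.
exact: lt_nbhsl.
Unshelve. all: by end_near. Qed.

(** * Integration by parts *)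

Lemma lipschitz_abs_continuous (R : realType) (a b C : R) (g : R -> R) :
  (forall x y, a <= x -> x <= y -> y <= b -> `|g y - g x| <= C * (y - x)) ->
  abs_continuous a b g.
Proof.
move=> lip e e0; have C0 : 0 < `|C| + 1 by rewrite ltr_wpDl.
exists (e / (`|C| + 1)); first by rewrite divr_gt0.
move=> m u v uv _; rewrite ltr_pdivlMr// mulrC mulr_sumr; apply: le_lt_trans.
apply: ler_sum => i _; have [au uvi vb] := uv i.
apply: le_trans (lip _ _ au uvi vb) _; apply: ler_wpM2r; first by rewrite subr_ge0.
by apply: le_trans (ler_norm _) _; rewrite lerDl.
Qed.

(** By the mean value theorem [g] is Lipschitz with constant [C]. *)
Lemma bounded_derive_abs_continuous (R : realType) (a b C : R) (g d : R -> R) :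
  {within `[a, b], continuous g} ->
  (forall x, a < x < b -> is_derive x 1 g (d x)) ->
  (forall x, a < x < b -> `|d x| <= C) -> abs_continuous a b g.
Proof.
move=> cg dg dC; apply: (@lipschitz_abs_continuous _ _ _ C) => x y ax.
rewrite le_eqVlt => /predU1P[<- _|xy yb]; first by rewrite !subrr normr0 mulr0.
have dgxy z : z \in `]x, y[ -> is_derive z 1 g (d z).
  by rewrite in_itv/= => /andP[xz zy]; apply: dg; lra.
have cgxy : {within `[x, y], continuous g}.
  by apply: continuous_subspaceW cg; apply: subset_itv; rewrite bnd_simp.
have [z] := MVT xy dgxy cgxy; rewrite in_itv/= => /andP[xz zy] ->.
rewrite normrM (ger0_norm (x := y - x)); last by rewrite subr_ge0 ltW.
by apply: ler_wpM2r; [rewrite subr_ge0 ltW|apply: dC; lra].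
Qed.

Lemma abs_continuous_bounded (R : realType) (a b : R) (g : R -> R) :
  abs_continuous a b g -> exists C, forall x, a <= x <= b -> `|g x| <= C.
Proof.
move=> ac; have [ab|ba] := leP a b; last by exists 0 => x; lra.
have bv := abs_continuous_bounded_variation ab ac.
exists (fine (total_variation a b g) + `|g a|) => x /andP[ax xb].
rewrite -[g x](subrK (g a)); apply: le_trans (ler_normD _ _) _; rewrite lerD2r.
rewrite -lee_fin fineK; last exact/bounded_variationP.
apply: le_trans (total_variation_ge _ ax) _.
by rewrite (total_variationD _ ax xb) leeDl// total_variation_ge0.
Qed.

Lemma abs_continuousM (R : realType) (a b : R) (f g : R -> R) :
  abs_continuous a b f -> abs_continuous a b g ->
  abs_continuous a b (fun x => f x * g x).
Proof.
move=> acf acg e e0.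
have [Cf hf] := abs_continuous_bounded acf.
have [Cg hg] := abs_continuous_bounded acg.
(* A common bound for both functions; the added 1 makes it positive, so that [e / (2 * C)] makes
   sense. *)
pose C := `|Cf| + `|Cg| + 1.
have C0 : 0 < C by rewrite /C ltr_wpDl// addr_ge0.
have e20 : 0 < e / (2 * C) by rewrite divr_gt0// mulr_gt0.
have [d1 d10 fd] := acf _ e20; have [d2 d20 gd] := acg _ e20.
exists (Num.min d1 d2); first by rewrite lt_min d10.
move=> m u v uv uvt; rewrite lt_min => /andP[uvd1 uvd2].
have := fd m u v uv uvt uvd1; have := gd m u v uv uvt uvd2.
move=> ge fe; apply: (@le_lt_trans _ _ (\sum_(i < m)
    (C * `|f (v i) - f (u i)| + C * `|g (v i) - g (u i)|))).
  apply: ler_sum => i _; have [au uvi vb] := uv i.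
  rewrite (_ : _ - _ = (f (v i) - f (u i)) * g (v i) +
    f (u i) * (g (v i) - g (u i))); last by ring.
  apply: le_trans (ler_normD _ _) _; rewrite !normrM [X in X + _]mulrC.
  apply: lerD; apply: ler_wpM2r => //.
    apply: le_trans (hg _ _) _; first by lra.
    by have := ler_norm Cg; have := normr_ge0 Cf; rewrite /C; lra.
  apply: le_trans (hf _ _) _; first by lra.
  by have := ler_norm Cf; have := normr_ge0 Cg; rewrite /C; lra.
rewrite big_split -!mulr_sumr/=.
have -> : e = C * (e / (2 * C)) + C * (e / (2 * C)).
  by field; rewrite gt_eqF.
by apply: ltrD; rewrite ltr_pM2l.
Qed.

Lemma abs_continuous_continuous (R : realType) (a b : R) (g : R -> R) :
  abs_continuous a b g -> {within `[a, b], continuous g}.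
Proof.
move=> ac; apply/subspace_continuousP => x xab; apply/cvgrPdist_lt => e.
move=> /(abs_continuous_dist ac)[d d0 ad].
near=> y.
have yab : y \in `[a, b] by near: y; exact: withinT.
have xyd : `|x - y| < d.
  near: y; apply: cvg_within; exact: (nbhsx_ballx x d d0).
move: xab yab xyd; rewrite /= !in_itv/= => /andP[ax xb] /andP[ay yb].
have [xy|yx] := leP x y.
  by rewrite distrC ger0_norm ?subr_ge0// distrC => /ad; apply.
by rewrite ger0_norm ?subr_ge0 ?ltW// => /ad; apply => //; exact: ltW.
Unshelve. all: by end_near. Qed.

Lemma abs_continuous_subitv (R : realType) (a b c d : R) (g : R -> R) :
  a <= c -> d <= b -> abs_continuous a b g -> abs_continuous c d g.
Proof.
move=> ac db acg e /acg[r r0 gr]; exists r => // m u v uv; apply: gr => i.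
by have [cu ? vd] := uv i; split => //; lra.
Qed.

Lemma ae_neq (R : realType) (c : R) : {ae @lebesgue_measure R, forall x, x != c}.
Proof.
exists [set c]; split => //; first exact: lebesgue_measure_set1.
by move=> x /= /negP; rewrite negbK => /eqP.
Qed.

Lemma ae_eq_integrable (R : realType) (D : set R) (f g : R -> R) :
  measurable (D : set (measurableTypeR R)) -> measurable_fun D f ->
  {ae @lebesgue_measure R, forall x, D x -> f x = g x} ->
  (@lebesgue_measure R).-integrable D (EFin \o g) ->
  (@lebesgue_measure R).-integrable D (EFin \o f) /\
  \int[@lebesgue_measure R]_(x in D) f x = \int[@lebesgue_measure R]_(x in D) g x.
Proof.
move=> mD mf fg ig; have /integrableP[mg goo] := ig.
have /measurable_EFinP mEf := mf.
split; last first.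
  congr fine; apply: ae_eq_integral => //.
  by apply: (@filterS _ _ (ae_filter_ringOfSetsType _)) fg => x h Dx /=; rewrite h.
apply/integrableP; split => //.
apply: le_lt_trans goo; rewrite le_eqVlt; apply/orP; left; apply/eqP.
apply: ae_eq_integral => //.
- exact: measurableT_comp.
- exact: measurableT_comp.
- by apply: (@filterS _ _ (ae_filter_ringOfSetsType _)) fg => x h Dx /=; rewrite h.
Qed.

Lemma continuous_itv_bounded (R : realType) (a b : R) (g : R -> R) :
  {within `[a, b], continuous g} -> exists C, forall x, a <= x <= b -> `|g x| <= C.
Proof.
move=> /continuous_compact/(_ (segment_compact (a := a) (b := b)))/compact_bounded.
move=> [M [_ gM]]; exists (M + 1) => x axb; apply: (gM (M + 1)); first by rewrite ltrDl.
by exists x => //=; rewrite in_itv.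
Qed.

(** The product [p * g] is absolutely continuous, hence the primitive of a density [k]. By the
    product rule [p * d] equals [k - p' * g] almost everywhere, and this difference is
    integrable. *)
Lemma abs_continuous_ibp (R : realType) (a b : R) (p p' g d : R -> R) :
  a < b -> abs_continuous a b g -> measurable_fun `[a, b] d ->
  {ae @lebesgue_measure R, forall x, a < x < b -> is_derive x 1 g (d x)} ->
  (forall x : R, is_derive x 1 p (p' x)) -> continuous p' ->
  (@lebesgue_measure R).-integrable `[a, b] (EFin \o (fun x => p x * d x)) /\
  \int[@lebesgue_measure R]_(x in `[a, b]) (p x * d x) =
  p b * g b - p a * g a - \int[@lebesgue_measure R]_(x in `[a, b]) (p' x * g x).
Proof.
move=> ab acg md gd pp' cp'.
have mD : measurable (`[a, b]%classic : set (measurableTypeR R)) by exact: measurable_itv.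
have cp : continuous p.
  by move=> x; apply/differentiable_continuous/derivable1_diffP; case: (pp' x).
have [C p'C] : exists C, forall x, a <= x <= b -> `|p' x| <= C.
  exact/continuous_itv_bounded/continuous_subspaceT.
have acp : abs_continuous a b p.
  apply: (@bounded_derive_abs_continuous _ _ _ C _ p').
  - exact: continuous_subspaceT.
  - by move=> x axb; apply: p'C; lra.
have [k [ik kE kd]] := abs_continuous_density ab (abs_continuousM acp acg).
have ik' : (@lebesgue_measure R).-integrable `[a, b] (EFin \o k).
  by apply: integrableS ik => //; exact: measurable_itv.
have ip'g : (@lebesgue_measure R).-integrable `[a, b] (EFin \o (fun x => p' x * g x)).
  apply: continuous_compact_integrable; first exact: segment_compact.
  have /subspace_continuousP cg := abs_continuous_continuous acg.
  apply/subspace_continuousP => x xab; apply: cvgM; last exact: cg.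
  by apply: cvg_within_filter; exact: cp'.
have aeq : {ae @lebesgue_measure R, forall x, `[a, b]%classic x ->
    p x * d x = k x - p' x * g x}.
  (* The derivatives are known only inside the interval; its endpoints form a null set. *)
  have nab : {ae @lebesgue_measure R, forall x, x != a /\ x != b}.
    by apply: (@filterS2 _ _ (ae_filter_ringOfSetsType _)) (ae_neq a) (ae_neq b).
  apply: (@filterS3 _ _ (ae_filter_ringOfSetsType _)) nab gd kd.
  move=> x [xa xb] gdx kdx; rewrite /= in_itv/= !le_eqVlt eq_sym (negbTE xa) (negbTE xb) /=.
  move=> axb; have dgx := gdx axb; have dpx := pp' x.
  have dpg : is_derive (x : R) 1 (p * g) (p x *: d x + g x *: p' x) by exact: is_deriveM.
  have e : k x = p x *: d x + g x *: p' x.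
    by rewrite -(@derive_val _ _ _ _ _ _ _ (kdx axb)) -(@derive_val _ _ _ _ _ _ _ dpg).
  by rewrite e /GRing.scale/=; ring.
have mpd : measurable_fun `[a, b] (fun x => p x * d x).
  apply: measurable_funM => //.
  by apply: measurable_funTS; exact: continuous_measurable_fun.
have [ipd ->] := ae_eq_integrable mD mpd aeq (integrableB mD ik' ip'g).
split => //; rewrite RintegralB//.
by have := kE b; rewrite lexx (ltW ab) => /(_ isT) ->; lra.
Qed.

(** * Derivatives relative to a segment *)

Lemma within_itvcc_dnbhs (R : realType) (a b x : R) :
  a < x < b -> within `[a, b] x^' = x^'.
Proof.
move=> axb; apply/seteqP; split => P /= hP; last exact: cvg_within hP.
have xab : \forall y \near x, a <= y <= b.
  near=> y; apply/andP; split; apply/ltW; near: y.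
    by apply: lt_nbhsr; lra.
  by apply: lt_nbhsl; lra.
have haby : \forall y \near x^', a <= y <= b by exact: nbhs_dnbhs.
have hP' : \forall y \near x^', `[a, b]%classic y -> P y := hP.
near=> y; have hy : `[a, b]%classic y -> P y by near: y.
by apply: hy; rewrite /= in_itv/=; near: y.
Unshelve. all: by end_near. Qed.

(** Caratheodory's criterion: the difference quotient, given the value [l] at [x], is continuous
    there. *)
Lemma diffquot_is_derive (R : realType) (f : R -> R) (x l : R) :
  diffquot f x y @[y --> x^'] --> l <-> is_derive x 1 f l.
Proof.
split => [fl|/(is_derive1_caratheodory f x l).1[g [fg cg <-]]].
  apply/(is_derive1_caratheodory f x l).
  exists (fun z => if z == x then l else diffquot f x z).
  rewrite eqxx; split => [z||//].
    have [->|zx] := eqVneq z x; first by rewrite !subrr mulr0.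
    by rewrite /diffquot divfK// subr_eq0.
  apply/continuous_withinNx; rewrite eqxx.
  apply: cvg_trans fl; apply: near_eq_cvg.
  by near=> z; rewrite ifF//; apply/negbTE; near: z; exact: nbhs_dnbhs_neq.
move/continuous_withinNx : cg; apply: cvg_trans; apply: near_eq_cvg.
near=> z; rewrite /diffquot fg mulfK// subr_eq0; near: z; exact: nbhs_dnbhs_neq.
Unshelve. all: by end_near. Qed.

Lemma derivable_on_is_derive (R : realType) (a b x : R) (f : R -> R) :
  a < x < b -> derivable_on `[a, b] f x ->
  is_derive x 1 f (derive_on `[a, b] f x).
Proof.
move=> axb; rewrite /derivable_on /derive_on (within_itvcc_dnbhs axb) => cf.
exact/diffquot_is_derive.
Qed.

Lemma is_derive_derive_on (R : realType) (a b x l : R) (f : R -> R) :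
  a < x < b -> is_derive x 1 f l -> derive_on `[a, b] f x = l.
Proof.
move=> axb /diffquot_is_derive fl; rewrite /derive_on (within_itvcc_dnbhs axb).
exact: cvg_lim.
Qed.

Lemma derivable_on_continuous (R : realType) (A : set R) (f : R -> R) :
  (forall x, A x -> derivable_on A f x) -> {within A, continuous f}.
Proof.
move=> df; apply/subspace_continuousP => x Ax.
have /cvg_ex[l fl] := df x Ax.
(* Off [x] this expression is [f y], and its limit is [f x + 0 * l]. *)
have h : (fun y => f x + (y - x) * diffquot f x y) @ within A x^' --> f x.
  rewrite -[X in _ --> X]addr0 -[X in _ + X](mul0r l).
  apply: cvgD; first exact: cvg_cst.
  apply: cvgM => //; rewrite -(subrr x); apply: cvgB; last exact: cvg_cst.
  by apply: cvg_within_filter; exact: nbhs_dnbhs.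
move=> P /= fP.
have hP : \forall y \near x, y != x -> A y ->
  P (f x + (y - x) * diffquot f x y) := h P fP.
suff : \forall y \near x, A y -> P (f y) by [].
near=> y; have [-> _|yx Ay] := eqVneq y x; first exact: nbhs_singleton.
have : P (f x + (y - x) * diffquot f x y).
  by move: yx Ay; near: y.
by rewrite /diffquot mulrC divfK ?subr_eq0// addrC subrK.
Unshelve. all: by end_near. Qed.

(** * Peano kernel representation of the error *)

(** [derive_on] takes a default value where the limit fails to exist; inside []a, b[] this happens
    only on a null set, since the density is a genuine derivative almost everywhere. *)
Lemma abs_continuous_ae_derive (R : realType) (a b : R) (g : R -> R) :
  a < b -> abs_continuous a b g ->
  {ae @lebesgue_measure R, forall x, a < x < b ->
    is_derive x 1 g (derive_on `[a, b] g x)}.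
Proof.
move=> ab ac; have [h [_ _ gh]] := abs_continuous_density ab ac.
apply: (@filterS _ _ (ae_filter_ringOfSetsType _)) gh => x gh axb.
by rewrite (is_derive_derive_on axb (gh axb)); exact: gh.
Qed.

Lemma continuous_deriven_on (R : realType) (a b : R) (n k : nat) (f : R -> R) :
  derivablen_on `[a, b] n f -> abs_continuous a b (deriven_on `[a, b] n f) ->
  (k <= n)%N -> {within `[a, b], continuous (deriven_on `[a, b] k f)}.
Proof.
move=> df ac; rewrite leq_eqVlt => /predU1P[->|kn].
  exact: abs_continuous_continuous.
by apply: derivable_on_continuous => x; exact: df.
Qed.

(** Below the top order the next derivative exists everywhere and is continuous on a compact
    segment, hence bounded. *)
Lemma abs_continuous_deriven_on (R : realType) (a b : R) (n k : nat) (f : R -> R) :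
  derivablen_on `[a, b] n f -> abs_continuous a b (deriven_on `[a, b] n f) ->
  (k <= n)%N -> abs_continuous a b (deriven_on `[a, b] k f).
Proof.
move=> df ac; rewrite leq_eqVlt => /predU1P[->//|kn].
have [C hC] := continuous_itv_bounded (continuous_deriven_on df ac kn).
apply: (@bounded_derive_abs_continuous _ _ _ C _ (deriven_on `[a, b] k.+1 f)).
- exact: continuous_deriven_on df ac (ltnW kn).
- move=> x axb; apply: derivable_on_is_derive => //; apply: df => //=.
  by rewrite in_itv/=; lra.
- by move=> x axb; apply: hC; lra.
Qed.

(* The Peano kernel of the rule is, up to the sign (-1)^n, peano_kernel n a   *)
(* (- theta h) on [a, (a + b) / 2] and peano_kernel n b (theta h) on          *)
(* [(a + b) / 2, b], where h = (b - a) / 2.                                   *)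
Definition peano_kernel (R : realType) (k : nat) (c l x : R) : R :=
  (x - c) ^+ k / k`!%:R + l * (if k is j.+1 then (x - c) ^+ j / j`!%:R else 0).

Lemma is_derive_taylor_monomial (R : realType) (k : nat) (c x : R) :
  is_derive x 1 (fun y => (y - c) ^+ k.+1 / k.+1`!%:R : R) ((x - c) ^+ k / k`!%:R).
Proof.
have h : is_derive x 1 (fun y : R => y - c) 1.
  by rewrite -[X in is_derive _ _ _ X]subr0; apply: is_deriveB.
rewrite (_ : (fun y => _) = k.+1`!%:R^-1 *: (fun y : R => y - c) ^+ k.+1); last first.
  by apply/funext => y; rewrite fctE /GRing.scale/= mulrC.
apply: is_derive_eq.
rewrite /GRing.scale/= mulr1 factS natrM.
have kf : k`!%:R != 0 :> R by rewrite pnatr_eq0 -lt0n fact_gt0.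
have k1 : k.+1%:R != 0 :> R by rewrite pnatr_eq0.
by move: (k.+1%:R) (k`!%:R) kf k1 => K L L0 K0; field; rewrite L0 K0.
Qed.

(** The case split in [peano_kernel] extends this to order 1, whose second term is the constant [l];
    the chain of derivatives ends in the constant 1 at order 0. *)
Lemma is_derive_peano_kernel (R : realType) (k : nat) (c l x : R) :
  is_derive x 1 (peano_kernel k.+1 c l) (peano_kernel k c l x).
Proof.
have h1 := is_derive_taylor_monomial k c x.
have h2 : is_derive x 1 (fun y : R => (y - c) ^+ k / k`!%:R)
    (if k is j.+1 then (x - c) ^+ j / j`!%:R else 0).
  case: {h1} k => [|k]; last exact: is_derive_taylor_monomial.
  by under eq_fun do rewrite expr0; exact: is_derive_cst.
exact: (is_deriveD h1 (is_deriveZ l h2)).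
Qed.

Lemma continuous_peano_kernel (R : realType) (k : nat) (c l : R) :
  continuous (peano_kernel k c l).
Proof.
case: k => [|k] x; last first.
  apply/differentiable_continuous/derivable1_diffP.
  by case: (is_derive_peano_kernel k c l x).
rewrite /peano_kernel; under eq_fun do rewrite expr0 mulr0.
exact: cvg_cst.
Qed.

Lemma Rintegral_itvU (R : realType) (a m b : R) (f : R -> R) :
  a <= m -> m <= b -> (@lebesgue_measure R).-integrable `[a, b] (EFin \o f) ->
  \int[@lebesgue_measure R]_(x in `[a, b]) f x =
  \int[@lebesgue_measure R]_(x in `[a, m]) f x +
  \int[@lebesgue_measure R]_(x in `[m, b]) f x.
Proof.
move=> am mb ifab; have := Rintegral_itvB ifab (x := m).
rewrite !bnd_simp => /(_ am mb) e; rewrite -(Rintegral_itv_obnd_cbnd (r := m)); last first.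
  apply: integrableS ifab; [exact: measurable_itv|exact: measurable_itv|].
  by apply: subset_itvr; rewrite bnd_simp.
by rewrite -e addrC subrK.
Qed.

Section peano_identity.
(** Here [n] is one less than in the theorem: order [n] is the absolutely continuous derivative and
    order [n.+1] the one defined almost everywhere. *)
Context (R : realType) (a b theta : R) (n : nat) (f : R -> R).
Context (ab : a < b) (df : derivablen_on `[a, b] n f)
  (ac : abs_continuous a b (deriven_on `[a, b] n f))
  (md : measurable_fun `[a, b] (deriven_on `[a, b] n.+1 f)).

Let m := (a + b) / 2.
Let h := (b - a) / 2.
Let D k := deriven_on `[a, b] k f.
(** [J 0] is the integral of [f], both kernels being 1 at order 0. *)
Let J k := \int[@lebesgue_measure R]_(x in `[a, m])
             (peano_kernel k a (- (theta * h)) x * D k x) +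
           \int[@lebesgue_measure R]_(x in `[m, b])
             (peano_kernel k b (theta * h) x * D k x).

Lemma measurable_deriven_on k : (k <= n.+1)%N -> measurable_fun `[a, b] (D k).
Proof.
rewrite leq_eqVlt => /predU1P[->//|]; rewrite ltnS => kn.
apply: subspace_continuous_measurable_fun; first exact: measurable_itv.
exact: continuous_deriven_on df ac kn.
Qed.

Lemma peano_ibp k u v c l : (k <= n)%N -> a <= u -> u < v -> v <= b ->
  (@lebesgue_measure R).-integrable `[u, v]
    (EFin \o (fun x => peano_kernel k.+1 c l x * D k.+1 x)) /\
  \int[@lebesgue_measure R]_(x in `[u, v]) (peano_kernel k.+1 c l x * D k.+1 x) =
  peano_kernel k.+1 c l v * D k v - peano_kernel k.+1 c l u * D k u
  - \int[@lebesgue_measure R]_(x in `[u, v]) (peano_kernel k c l x * D k x).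
Proof.
move=> kn au uv vb.
have acD := abs_continuous_deriven_on df ac kn.
apply: abs_continuous_ibp => //.
- exact: abs_continuous_subitv acD.
- apply: measurable_funS (measurable_deriven_on (k := k.+1) kn).
  + exact: measurable_itv.
  + by apply: subset_itv; rewrite bnd_simp.
- apply: (@filterS _ _ (ae_filter_ringOfSetsType _)) (abs_continuous_ae_derive ab acD).
  by move=> x h1 uxv; apply: h1; lra.
- by move=> x; exact: is_derive_peano_kernel.
- exact: continuous_peano_kernel.
Qed.

Lemma mid_itv : [/\ a < m, m < b, m - a = h & m - b = - h].
Proof. by move: ab; rewrite /m /h => ab'; split; [lra|lra|field|field]. Qed.

Lemma peano_step k : (k <= n)%N ->
  J k.+1 = (peano_kernel k.+1 a (- (theta * h)) m -
            peano_kernel k.+1 b (theta * h) m) * D k m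
         + peano_kernel k.+1 b (theta * h) b * D k b
         - peano_kernel k.+1 a (- (theta * h)) a * D k a - J k.
Proof.
move=> kn; have [am mb _ _] := mid_itv.
have [_ e1] := peano_ibp a (- (theta * h)) kn (lexx a) am (ltW mb).
have [_ e2] := peano_ibp b (theta * h) kn (ltW am) mb (lexx b).
by rewrite /J e1 e2; ring.
Qed.

(** From order 2 on the kernels vanish at the outer endpoints, so [a] and [b] contribute only to the
    first integration by parts. *)
Lemma peano_kernel0 (k : nat) (c l : R) : peano_kernel k.+2 c l c = 0.
Proof. by rewrite /peano_kernel subrr !expr0n /= !mul0r mulr0 addr0. Qed.

(* For k odd the two halves of the kernel agree at the midpoint; for k even   *)
(* their jump there produces the k-th derivative term of quadF.               *)
Lemma peano_kernel_mid k :
  peano_kernel k.+1 b (theta * h) m =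
  (-1) ^+ k.+1 * peano_kernel k.+1 a (- (theta * h)) m /\
  peano_kernel k.+1 a (- (theta * h)) m =
    (1 - theta * k.+1%:R) * h ^+ k.+1 / k.+1`!%:R.
Proof.
have [_ _ ma mb] := mid_itv.
rewrite /peano_kernel ma mb (exprNn h k) (exprNn h k.+1) factS natrM !exprS.
have kf : k`!%:R != 0 :> R by rewrite pnatr_eq0 -lt0n fact_gt0.
have k1 : k.+1%:R != 0 :> R by rewrite pnatr_eq0.
move: (k.+1%:R) (k`!%:R) kf k1 => K L L0 K0.
by split; field; rewrite L0 K0.
Qed.

(** The upper summation index at [k.+1] is the integer part of [k / 2], so a new summand, with
    [2 * i = k], appears exactly when [k] is even. *)
Lemma quadF_step k : (0 < k)%N ->
  quadF a b f theta k.+1 - quadF a b f theta k =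
  (if odd k then 0 else
    (1 - theta * k.+1%:R) * (b - a) ^+ k.+1 / (k.+1`!%:R * 2 ^+ k) * D k m).
Proof.
case: k => // k _; rewrite /quadF !subn1 [LHS](_ : _ = 
  \sum_(1 <= i < (k.+1 %/ 2).+1)
      (1 - theta * (2 * i + 1)%:R) * (b - a) ^+ (2 * i + 1)
        / ((2 * i + 1)`!%:R * 2 ^+ (2 * i)) * D (2 * i) m -
  \sum_(1 <= i < (k %/ 2).+1)
      (1 - theta * (2 * i + 1)%:R) * (b - a) ^+ (2 * i + 1)
        / ((2 * i + 1)`!%:R * 2 ^+ (2 * i)) * D (2 * i) m); last first.
  by rewrite /m /D /=; ring.
(* The index of the statement is now [k.+1], so odd [k] is the case with a new summand. *)
have [ok|ek] := boolP (odd k).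
  have -> : (k.+1 %/ 2)%N = (k %/ 2).+1.
    by rewrite !divn2 /= uphalf_half ok.
  rewrite big_nat_recr// [X in X - _]addrC addrK.
  have -> : (2 * (k %/ 2).+1)%N = k.+1.
    by rewrite divn2; have := odd_double_half k; rewrite ok -mul2n; lia.
  by rewrite addn1 oddS ok.
have -> : (k.+1 %/ 2)%N = (k %/ 2)%N by rewrite !divn2 /= uphalf_half (negbTE ek).
by rewrite oddS ek subrr.
Qed.

Lemma quadF1 : quadF a b f theta 1 =
  (b - a) * ((1 - theta) * f m + theta * ((f a + f b) / 2)).
Proof. by rewrite /quadF big_geq// addr0. Qed.

(** By induction: the boundary terms of the first round are [quadF] at 1, and the jump of the kernel
    at the midpoint in each later round is the increment given by [quadF_step]. *)
Lemma peano_identity k : (k <= n)%N ->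
  (-1) ^+ k.+1 * J k.+1 =
  \int[@lebesgue_measure R]_(x in `[a, b]) f x - quadF a b f theta k.+1.
Proof.
elim: k => [|k ih] kn.
  rewrite peano_step// quadF1.
  have [am mb ma mb'] := mid_itv.
  have -> : J 0 = \int[@lebesgue_measure R]_(x in `[a, b]) f x.
    have J0 u v c l : \int[@lebesgue_measure R]_(x in `[u, v])
        (peano_kernel 0 c l x * D 0 x) = \int[@lebesgue_measure R]_(x in `[u, v]) f x.
      apply: eq_Rintegral => x _.
      by rewrite /peano_kernel expr0 fact0 divr1 mulr0 addr0 mul1r.
    rewrite /J !J0 -Rintegral_itvU// ?(ltW am) ?(ltW mb)//.
    apply: continuous_compact_integrable; first exact: segment_compact.
    exact: (continuous_deriven_on df ac (leq0n n)).
  rewrite /peano_kernel !expr1 !expr0 !fact0 ma mb' !subrr /D /= /m /h.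
  rewrite (_ : 1`! = 1)%N// !mulr1n.
  by field.
rewrite peano_step// exprS mulrBr.
have -> : -1 * (-1) ^+ k.+1 * J k.+1 = - ((-1) ^+ k.+1 * J k.+1) by ring.
rewrite ih ?(ltnW kn)// opprK.
have -> : quadF a b f theta k.+2 = quadF a b f theta k.+1 +
  (quadF a b f theta k.+2 - quadF a b f theta k.+1) by ring.
rewrite quadF_step// !peano_kernel0 !mul0r subr0 addr0.
have [-> ->] := peano_kernel_mid k.+1.
rewrite /h expr_div_n.
have kf : k.+2`!%:R != 0 :> R by rewrite pnatr_eq0 -lt0n fact_gt0.
have [ok|ek] := boolP (odd k.+1).
  rewrite (_ : (-1) ^+ k.+2 = 1) -?exprS; last by rewrite -signr_odd oddS ok.
  by rewrite mul1r subrr mul0r mulr0 add0r addr0.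
(* For even [k.+1] the two one-sided values at the midpoint are opposite, so the jump is twice one
   of them and cancels one factor of [2 ^+ k.+2]. *)
rewrite [(-1) ^+ k.+2]exprS (_ : (-1) ^+ k.+1 = 1); last by rewrite -signr_odd (negbTE ek).
rewrite [2 ^+ k.+2]exprS.
have p2 : 2 ^+ k.+1 != 0 :> R by rewrite expf_neq0.
move: (2 ^+ k.+1) (k.+2`!%:R) ((b - a) ^+ k.+2) p2 kf => A B C A0 B0.
by field; rewrite A0 B0.
Qed.

End peano_identity.

(** * Cauchy-Schwarz and the norm of the kernel *)

Lemma Rintegral_is_derive (R : realType) (u v : R) (F F' : R -> R) : u < v ->
  (forall x : R, is_derive x 1 F (F' x)) -> continuous F' ->
  \int[@lebesgue_measure R]_(x in `[u, v]) F' x = F v - F u.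
Proof.
move=> uv FF' cF'.
have cF : continuous F.
  by move=> x; apply/differentiable_continuous/derivable1_diffP; case: (FF' x).
rewrite /Rintegral (@continuous_FTC2 _ _ F)//.
- exact: continuous_subspaceT.
- split; [by move=> x _; case: (FF' x)| |].
  + exact/cvg_at_right_filter/cF.
  + exact/cvg_at_left_filter/cF.
- by move=> x _; rewrite derive1E; exact: (@derive_val _ _ _ _ _ _ _ (FF' x)).
Qed.

Lemma in_L2_measurable (R : realType) (a b : R) (g : R -> R) :
  in_L2 a b g -> measurable_fun `[a, b] g.
Proof.
move=> /andP[+ _]; rewrite inE /= => mg.
apply/measurable_restrictT; first exact: measurable_itv.
exact: mg.
Qed.

(** Hoelder's inequality with exponents 2 and 2 for the extensions by 0; it also yields the
    integrability of the product. *)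
Lemma cauchy_schwarz_L2 (R : realType) (a b : R) (K g : R -> R) :
  measurable_fun `[a, b] K ->
  (@lebesgue_measure R).-integrable `[a, b] (EFin \o (fun x => K x ^+ 2)) ->
  in_L2 a b g ->
  (@lebesgue_measure R).-integrable `[a, b] (EFin \o (fun x => K x * g x)) /\
  `|\int[@lebesgue_measure R]_(x in `[a, b]) (K x * g x)| <=
    Num.sqrt (\int[@lebesgue_measure R]_(x in `[a, b]) K x ^+ 2) * L2norm a b g.
Proof.
move=> mK iK2 gL2; have mg := in_L2_measurable gL2.
have mD : measurable (`[a, b]%classic : set (measurableTypeR R)) by exact: measurable_itv.
have N2g : ('N[@lebesgue_measure R]_(2%:E) [EFin \o g \_ `[a, b]] = (L2norm a b g)%:E)%E.
  rewrite /L2norm fineK// ge0_fin_numE ?Lnorm_ge0//.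
  by move: gL2 => /andP[_]; rewrite inE.
have N2K : ('N[@lebesgue_measure R]_(2%:E) [EFin \o K \_ `[a, b]] =
    (Num.sqrt (\int[@lebesgue_measure R]_(x in `[a, b]) K x ^+ 2))%:E)%E.
  rewrite unlock /=.
  have -> : (\int[@lebesgue_measure R]_x (`|(K \_ `[a, b]) x| `^ 2)%:E =
      (\int[@lebesgue_measure R]_(x in `[a, b]) (K x ^+ 2))%:E)%E.
    rewrite /Rintegral fineK; last exact: (integrable_fin_num mD iK2).
    rewrite [RHS]integral_mkcond; apply: eq_integral => x _.
    rewrite /patch; case: ifPn => _; last by rewrite normr0 powR0.
    by rewrite powR_mulrn ?normr_ge0// real_normK ?num_real.
  by rewrite poweR_EFin powR12_sqrt// Rintegral_ge0// => x _; exact: sqr_ge0.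
have mKr : measurable_fun setT (K \_ `[a, b]) by apply/(measurable_restrictT _ mD).
have mgr : measurable_fun setT (g \_ `[a, b]) by apply/(measurable_restrictT _ mD).
have half : (2^-1 + 2^-1 = 1 :> R)%R by field.
have two0 : 0 < 2 :> R by [].
have := hoelder (@lebesgue_measure R) mKr mgr two0 two0 half.
rewrite N2K N2g Lnorm1 -EFinM => H.
have mKg : measurable_fun `[a, b] (fun x => K x * g x) by exact: measurable_funM.
have /measurable_EFinP mEKg := mKg.
have {}H : (\int[@lebesgue_measure R]_(x in `[a, b]) `|(K x * g x)%:E| <=
    (Num.sqrt (\int[@lebesgue_measure R]_(x in `[a, b]) K x ^+ 2) *
      L2norm a b g)%:E)%E.
  apply: le_trans H.
  have -> : (\int[@lebesgue_measure R]_(x in `[a, b]) `|(K x * g x)%:E| =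
      \int[@lebesgue_measure R]_x `|((K \_ `[a, b]) x * (g \_ `[a, b]) x)%:E|)%E.
    rewrite [LHS]integral_mkcond; apply: eq_integral => x _.
    by rewrite /patch /=; case: ifPn => _ //; rewrite mul0r normr0.
  exact: lexx.
have iKg : (@lebesgue_measure R).-integrable `[a, b] (EFin \o (fun x => K x * g x)).
  by apply/integrableP; split => //; exact: le_lt_trans H (ltry _).
split => //; rewrite -lee_fin EFin_normr_Rintegral//.
by apply: le_trans (le_abse_integral _ mD mEKg) H.
Qed.

Lemma Rintegral_itv_if (R : realType) (a m b : R) (f g : R -> R) :
  a <= m -> m <= b ->
  (@lebesgue_measure R).-integrable `[a, b] (EFin \o (fun x => if x <= m then f x else g x)) ->
  (@lebesgue_measure R).-integrable `[m, b] (EFin \o g) ->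
  \int[@lebesgue_measure R]_(x in `[a, b]) (if x <= m then f x else g x) =
  \int[@lebesgue_measure R]_(x in `[a, m]) f x +
  \int[@lebesgue_measure R]_(x in `[m, b]) g x.
Proof.
move=> am mb ifg ig; rewrite (Rintegral_itvU am mb ifg); congr (_ + _).
  by apply: eq_Rintegral => x; rewrite inE/= in_itv/= => /andP[_ ->].
have sub : `]m, b] `<=` `[m, b] by apply: subset_itvr; rewrite bnd_simp.
rewrite -(Rintegral_itv_obnd_cbnd (r := m)); last first.
  apply: integrableS ifg; [exact: measurable_itv|exact: measurable_itv|].
  by apply: subset_itv; rewrite bnd_simp.
rewrite -[RHS](Rintegral_itv_obnd_cbnd (r := m)); last first.
  by apply: integrableS ig; [exact: measurable_itv|exact: measurable_itv|].
by apply: eq_Rintegral => x; rewrite inE/= in_itv/= ltNge => /andP[/negbTE ->].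
Qed.

(** The termwise primitive, vanishing at [c], of the expanded square of [peano_kernel k.+1 c l]. *)
Definition peano_sqr_primitive (R : realType) (k : nat) (c l x : R) : R :=
  (x - c) ^+ (k * 2).+3 / ((k * 2).+3%:R * k.+1`!%:R ^+ 2)
  + 2 * l * (x - c) ^+ (k * 2).+2 / ((k * 2).+2%:R * (k.+1`!%:R * k`!%:R))
  + l ^+ 2 * (x - c) ^+ (k * 2).+1 / ((k * 2).+1%:R * k`!%:R ^+ 2).

Lemma Rintegral_peano_kernel_sqr (R : realType) (k : nat) (c l u v : R) : u < v ->
  \int[@lebesgue_measure R]_(x in `[u, v]) peano_kernel k.+1 c l x ^+ 2 =
  peano_sqr_primitive k c l v - peano_sqr_primitive k c l u.
Proof.
move=> uv; pose F := peano_sqr_primitive k c l.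
have dpow j (x : R) : is_derive x 1 (fun y => (y - c) ^+ j.+1 / j.+1%:R : R) ((x - c) ^+ j).
  have jf : j`!%:R != 0 :> R by rewrite pnatr_eq0 -lt0n fact_gt0.
  have j1 : j.+1%:R != 0 :> R by rewrite pnatr_eq0.
  have := is_deriveZ j`!%:R (is_derive_taylor_monomial j c x).
  rewrite /GRing.scale/= mulrC divfK// (_ : _ \*: _ = (fun y => (y - c) ^+ j.+1 / j.+1%:R))//.
  apply/funext => y; rewrite -[LHS]/(j`!%:R * ((y - c) ^+ j.+1 / j.+1`!%:R)).
  rewrite factS natrM.
  by move: (j.+1%:R) (j`!%:R) jf j1 => A B B0 A0; field; rewrite A0 B0.
apply: (Rintegral_is_derive (F := F) uv); last first.
  by move=> x; apply: cvgM; exact: continuous_peano_kernel.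
move=> x.
have := is_deriveD (is_deriveD (is_deriveZ (k.+1`!%:R ^- 2) (dpow (k * 2).+2 x))
  (is_deriveZ (2 * l / (k.+1`!%:R * k`!%:R)) (dpow (k * 2).+1 x)))
  (is_deriveZ (l ^+ 2 / k`!%:R ^+ 2) (dpow (k * 2)%N x)).
rewrite (_ : _ \*: _ + _ \*: _ + _ \*: _ = F); last first.
  apply/funext => y; rewrite /F /peano_sqr_primitive.
  rewrite -[LHS]/(k.+1`!%:R ^- 2 * ((y - c) ^+ (k * 2).+3 / (k * 2).+3%:R) +
    2 * l / (k.+1`!%:R * k`!%:R) * ((y - c) ^+ (k * 2).+2 / (k * 2).+2%:R) +
    l ^+ 2 / k`!%:R ^+ 2 * ((y - c) ^+ (k * 2).+1 / (k * 2).+1%:R)).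
  rewrite !invfM; ring.
move=> h; apply: (is_derive_eq h).
rewrite -[LHS]/(k.+1`!%:R ^- 2 * (x - c) ^+ (k * 2).+2 +
    2 * l / (k.+1`!%:R * k`!%:R) * (x - c) ^+ (k * 2).+1 +
    l ^+ 2 / k`!%:R ^+ 2 * (x - c) ^+ (k * 2)).
rewrite /peano_kernel !exprS exprM.
have kf : k`!%:R != 0 :> R by rewrite pnatr_eq0 -lt0n fact_gt0.
have kf1 : k.+1`!%:R != 0 :> R by rewrite pnatr_eq0 -lt0n fact_gt0.
by move: (k.+1`!%:R) (k`!%:R) kf kf1 => A B B0 A0; field; rewrite A0 B0.
Qed.

(** With n = k+1 and h = (b-a)/2, each half contributes h^(2n+1)/n!^2 times 1/(2n+1) - theta +
    theta^2 n^2/(2n-1). *)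
Lemma sqr_norm_peano_kernel (R : realType) (k : nat) (a b theta : R) :
  a < b ->
  \int[@lebesgue_measure R]_(x in `[a, (a + b) / 2])
    peano_kernel k.+1 a (- (theta * ((b - a) / 2))) x ^+ 2 +
  \int[@lebesgue_measure R]_(x in `[(a + b) / 2, b])
    peano_kernel k.+1 b (theta * ((b - a) / 2)) x ^+ 2 =
  (b - a) * ((b - a) ^+ k.+1 / (k.+1`!%:R * 2 ^+ k.+1)) ^+ 2 *
  ((theta ^+ 2 * k.+1%:R ^+ 2 * (2 * k.+1%:R + 1)
    - theta * (4 * k.+1%:R ^+ 2 - 1) + (2 * k.+1%:R - 1))
   / ((2 * k.+1%:R + 1) * (2 * k.+1%:R - 1))).
Proof.
move=> ab; rewrite !Rintegral_peano_kernel_sqr; [|lra..].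
rewrite /peano_sqr_primitive !subrr !expr0n /= !mul0r !mulr0 !mul0r !addr0 subr0 sub0r.
have -> : (a + b) / 2 - a = (b - a) / 2 by field.
have -> : (a + b) / 2 - b = - ((b - a) / 2) by field.
have -> : (b - a) = 2 * ((b - a) / 2) by field.
move: ((b - a) / 2) => h.
rewrite -[2 * h / 2]mulrAC divff// mul1r.
rewrite [(2 * h) ^+ k.+1]exprMn !(exprS _ (k * 2).+2) !(exprS _ (k * 2).+1) !(exprS _ (k * 2)).
rewrite !(exprS _ k) !exprM.
have -> : ((- h) ^+ k) ^+ 2 = (h ^+ k) ^+ 2 by rewrite -!exprM mulnC !exprM sqrrN.
have kf : k`!%:R != 0 :> R by rewrite pnatr_eq0 -lt0n fact_gt0.
have p2 : 2 ^+ k != 0 :> R by rewrite expf_neq0.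
have k0 : 0 <= k%:R :> R by [].
have -> : (k * 2).+3%:R = 2 * k%:R + 3 :> R by rewrite -addn3 natrD natrM; ring.
have -> : (k * 2).+2%:R = 2 * k%:R + 2 :> R by rewrite -addn2 natrD natrM; ring.
have -> : (k * 2).+1%:R = 2 * k%:R + 1 :> R by rewrite -addn1 natrD natrM; ring.
have e1 : k.+1%:R = k%:R + 1 :> R by rewrite natr1.
rewrite factS natrM e1.
move: (h ^+ k) (2 ^+ k) (k`!%:R) (k%:R) kf p2 k0 => A B C K C0 B0 K0.
field; rewrite B0 C0 /=.
by apply/and4P; split; apply: lt0r_neq0; lra.
Qed.

Theorem theorem5 (R : realType) (a b : R) (n : nat) (f : R -> R)
    (hab : a < b) (hn : (1 < n)%N)
    (hder : derivablen_on `[a, b] (n - 1) f)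
    (hac : abs_continuous a b (deriven_on `[a, b] (n - 1) f))
    (hL2 : in_L2 a b (deriven_on `[a, b] n f)) :
  forall theta : R, 0 <= theta <= 1 ->
    `|\int[@lebesgue_measure R]_(x in `[a, b]) f x - quadF a b f theta n|
      <= (b - a) `^ (n%:R + 2^-1) / (n`!%:R * 2 ^+ n)
         * L2norm a b (deriven_on `[a, b] n f)
         * Num.sqrt ((theta ^+ 2 * n%:R ^+ 2 * (2 * n%:R + 1)
                      - theta * (4 * n%:R ^+ 2 - 1) + (2 * n%:R - 1))
                     / ((2 * n%:R + 1) * (2 * n%:R - 1))).
Proof.
move=> theta _; case: n hn hder hac hL2 => // k _; rewrite subn1 => df ac dL2.
have md := in_L2_measurable dL2.
rewrite -(peano_identity theta hab df ac md (leqnn k)).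
have [am mb _ _] := mid_itv hab.
have [iA _] := peano_ibp hab df ac md a (- (theta * ((b - a) / 2))) (leqnn k) (lexx a) am (ltW mb).
have [iB _] := peano_ibp hab df ac md b (theta * ((b - a) / 2)) (leqnn k) (ltW am) mb (lexx b).
set A := peano_kernel k.+1 a (- (theta * ((b - a) / 2))) in iA *.
set B := peano_kernel k.+1 b (theta * ((b - a) / 2)) in iB *.
set m := (a + b) / 2 in am mb iA iB *.
set g := deriven_on `[a, b] k.+1 f in iA iB md dL2 *.
(* Gluing the two kernels lets Cauchy-Schwarz be applied once on [[a, b]], with the full norm of
   [g]. *)
pose K x := if x <= m then A x else B x.
have cA : continuous A by exact: continuous_peano_kernel.
have cB : continuous B by exact: continuous_peano_kernel.
have mK : measurable_fun setT K.
  apply: measurable_fun_ifT; [|exact: continuous_measurable_fun..].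
  by apply: measurable_fun_ler.
have cAB2 : continuous (fun x => A x ^+ 2 + B x ^+ 2).
  by move=> x; apply: cvgD; apply: cvgM; [exact: cA..|exact: cB|exact: cB].
have mD : measurable (`[a, b]%classic : set (measurableTypeR R)) by exact: measurable_itv.
have iK2 : (@lebesgue_measure R).-integrable `[a, b] (EFin \o (fun x => K x ^+ 2)).
  apply: (@le_integrable _ _ _ _ _ mD _ (EFin \o (fun x => A x ^+ 2 + B x ^+ 2))).
  - by apply/measurable_EFinP/measurable_funTS; apply: measurable_funX.
  - move=> x _; rewrite lee_fin !ger0_norm ?addr_ge0 ?sqr_ge0//.
    by rewrite /K; case: ifP => _; rewrite ?lerDl ?lerDr sqr_ge0.
  - apply: continuous_compact_integrable; first exact: segment_compact.
    exact: continuous_subspaceT.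
have [iKg CS] := cauchy_schwarz_L2 (measurable_funTS mK) iK2 dL2.
have KgE x : K x * g x = if x <= m then A x * g x else B x * g x.
  by rewrite /K; case: ifP.
have -> : \int[@lebesgue_measure R]_(x in `[a, m]) (A x * g x) +
    \int[@lebesgue_measure R]_(x in `[m, b]) (B x * g x) =
    \int[@lebesgue_measure R]_(x in `[a, b]) (K x * g x).
  under [RHS]eq_Rintegral do rewrite KgE.
  rewrite Rintegral_itv_if ?ltW//.
  by apply: eq_integrable iKg => // x _ /=; rewrite KgE.
rewrite normrM normrX normrN1 expr1n mul1r.
apply: le_trans CS _; rewrite mulrAC [leLHS]mulrC [leRHS]mulrC ler_wpM2l//.
  by rewrite /L2norm fine_ge0// Lnorm_ge0.
have -> : \int[@lebesgue_measure R]_(x in `[a, b]) K x ^+ 2 =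
    \int[@lebesgue_measure R]_(x in `[a, m]) A x ^+ 2 +
    \int[@lebesgue_measure R]_(x in `[m, b]) B x ^+ 2.
  have K2E x : K x ^+ 2 = if x <= m then A x ^+ 2 else B x ^+ 2.
    by rewrite /K; case: ifP.
  under eq_Rintegral do rewrite K2E.
  rewrite Rintegral_itv_if ?ltW//.
    by apply: eq_integrable iK2 => // x _ /=; rewrite K2E.
  apply: continuous_compact_integrable; first exact: segment_compact.
  by apply: continuous_subspaceT => x; apply: cvgM; exact: cB.
rewrite sqr_norm_peano_kernel//.
have ba : 0 < b - a by rewrite subr_gt0.
(* The half power of [b - a] is the square root of the factor [b - a] in the squared norm of the
   kernel. *)
rewrite powRD; last by rewrite (gt_eqF ba) implybT.
rewrite (powR_mulrn _ (ltW ba)) (powR12_sqrt (ltW ba)).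
set c := (b - a) ^+ k.+1 / _; have c0 : 0 <= c.
  by rewrite /c divr_ge0 ?mulr_ge0 ?exprn_ge0// ltW.
rewrite sqrtrM; last by rewrite mulr_ge0 ?sqr_ge0// ltW.
rewrite sqrtrM ?(ltW ba)// sqrtr_sqr (ger0_norm c0).
by rewrite /c mulrA (mulrC (Num.sqrt (b - a))).
Qed.
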